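(* Let $\mathcal X=([v],\{R_i\}_{i=0}^d)$ be a symmetric association scheme. Let $k$ be a positive integer and let $A$ be a $v\times v$ complex diagonalisable matrix such that (1) $D_A(k)=\{a,b,c\}$ where $|D_A(k)|=3$; (2) for each $i\in\{0,1\}$ there is a constant $c_i$ with $c_A(\alpha,k)=c_i$ for all $\alpha\in\binom{[v]}{i}$, and for each $j\in\{1,\dots,d\}$ there is a constant $c_2(j)$ with $c_A(\alpha,k)=c_2(j)$ for all $\alpha\in\tilde R_j$; and (3) the hypergraph $\mathfrak H_A(v,k,c)$ is a $\operatorname{PBIBD}(v,k;\eta_2(1),\dots,\eta_2(d))$ on $\mathcal X$. Then the hypergraph $\mathfrak H_A(v,k,a)$ is a $\operatorname{PBIBD}(v,k;\lambda_1,\dots,\lambda_d)$ on $\mathcal X$ where, for each $j\in\{1,\dots,d\}$, $$\lambda_j=\frac{(-1)^k}{a-b}\bigl(c_0-2c_1+c_2(j)\bigr)-\frac{b}{a-b}\binom{v-2}{k-2}-\frac{c-b}{a-b}\,\eta_2(j).$$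
   Context: $[v]=\{1,\dots,v\}$; $\binom{[v]}{k}$ is the set of $k$-subsets of $[v]$. For a $v\times v$ matrix $A$ and $\alpha\subset[v]$, $A[\alpha]$ is the principal submatrix indexed by $\alpha$ and $\overline\alpha=[v]\setminus\alpha$. $D_A(k)=\{\det(A[\alpha]):\alpha\in\binom{[v]}{k}\}$. $c_A(\alpha,k)$ is the coefficient of $x^{v-k-|\alpha|}$ in $\det(xI-A[\overline\alpha])$. $\mathfrak H_A(v,k,a)$ is the $k$-uniform hypergraph on $[v]$ whose hyperedges are the $k$-subsets $\alpha$ with $\det(A[\alpha])=a$. A symmetric association scheme with $d\ge1$ classes on a finite set $\mathfrak X$ is $(\mathfrak X,\{R_i\}_{i=0}^d)$, with $R_i$ nonempty subsets of $\mathfrak X\times\mathfrak X$ whose $\{0,1\}$ adjacency matrices $A_i$ (with $(A_i)_{xy}=1$ iff $(x,y)\in R_i$) satisfy: $A_0=I$; $\sum_{i=0}^dA_i=J$ (all-ones); $A_i^{\top}=A_i$ for all $i$; and every product $A_iA_j$ lies in the linear span of $A_0,\dots,A_d$. Write $\tilde R_i=\{\{x,y\}:(x,y)\in R_i\}$. A $\operatorname{PBIBD}(v,k;\lambda_1,\dots,\lambda_d)$ (partially balanced incomplete block design) on this scheme, $|\mathfrak X|=v$, is a $k$-uniform hypergraph $(\mathfrak X,\mathfrak B)$ that is a $1$-design (every vertex lies in the same positive number of hyperedges) and such that for each $i\in\{1,\dots,d\}$ and each $(x,y)\in R_i$, the pair $\{x,y\}$ is contained in exactly $\lambda_i$ hyperedges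 ($\lambda_i\geq0$). *)

(* Defs.v *)
From HB Require Import structures.
From mathcomp Require Import all_boot all_order all_algebra.
From mathcomp Require Import finmap.

Set Implicit Arguments.
Unset Strict Implicit.
Unset Printing Implicit Defensive.

Import GRing.Theory.
Local Open Scope ring_scope.

(* The vertex set [v] = {1, ..., v} is represented by 'I_v. *)

Definition ksubsets (v k : nat) : {set {set 'I_v}} :=
  [set alpha : {set 'I_v} | #|alpha| == k].

Section PrincipalMinors.
Variables (F : fieldType) (v : nat) (A : 'M[F]_v).

Definition principal_submx (alpha : {set 'I_v}) : 'M[F]_#|alpha| :=
  mxsub (@enum_val _ (mem alpha)) (@enum_val _ (mem alpha)) A.

(* D_A(k) *)
Definition minor_set (k : nat) : {fset F} :=
  [fset \det (principal_submx alpha) | alpha in ksubsets v k]%fset.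

(* c_A(alpha, k). The exponent v - k - #|alpha| may be negative, in which case
   the coefficient is 0; truncated subtraction would instead return the
   constant coefficient. *)
Definition char_coef (alpha : {set 'I_v}) (k : nat) : F :=
  if (k + #|alpha| <= v)%N
  then (char_poly (principal_submx (~: alpha)))`_(v - k - #|alpha|)
  else 0.

(* H_A(v, k, a), given by its set of hyperedges. *)
Definition minor_hypergraph (k : nat) (a : F) : {set {set 'I_v}} :=
  [set alpha in ksubsets v k | \det (principal_submx alpha) == a].

End PrincipalMinors.

Section AssociationSchemes.
Variables (v d : nat) (R : 'I_d.+1 -> {set 'I_v * 'I_v}).

Definition adjacency (F : fieldType) (i : 'I_d.+1) : 'M[F]_v :=
  \matrix_(x, y) ((x, y) \in R i)%:R.

(* F is the field over which the linear span is taken. *)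
Definition symmetric_association_scheme (F : fieldType) : Prop :=
  [/\ (1 <= d)%N,
      forall i, R i != set0,
      adjacency F ord0 = 1%:M,
      \sum_i adjacency F i = const_mx 1 &
      (forall i, (adjacency F i)^T = adjacency F i) /\
      (forall i j, adjacency F i *m adjacency F j
                     \in <<[seq adjacency F l | l : 'I_d.+1]>>%VS)].

(* The set of unordered pairs {x, y} with (x, y) \in R_i. *)
Definition unordered_rel (i : 'I_d.+1) : {set {set 'I_v}} :=
  [set [set p.1; p.2] | p in R i].

Definition uniform (k : nat) (B : {set {set 'I_v}}) : Prop :=
  forall e, e \in B -> #|e| = k.

Definition one_design (B : {set {set 'I_v}}) : Prop :=
  exists2 r : nat, (0 < r)%N & forall x, #|[set e in B | x \in e]| = r.

(* The index j : 'I_d stands for the class j + 1 of {1, ..., d}, whose relation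
   is R (lift ord0 j). *)
Definition PBIBD (k : nat) (lambda : 'I_d -> nat) (B : {set {set 'I_v}}) :
    Prop :=
  [/\ uniform k B,
      one_design B &
      forall (j : 'I_d) (x y : 'I_v), (x, y) \in R (lift ord0 j) ->
        #|[set e in B | [set x; y] \subset e]| = lambda j].

End AssociationSchemes.

(* 'C(v - 2, k - 2), read as 0 when k < 2 (truncated subtraction would give
   1 there). *)
Definition binom_sub2 (v k : nat) : nat :=
  if (2 <= k)%N then 'C(v - 2, k - 2) else 0%N.

(* Main.v *)
(* The coefficient of x^(v-k-|alpha|) in det(xI - A[~: alpha]) is (-1)^k times
   the sum of the k x k principal minors of A avoiding alpha. By
   inclusion-exclusion, conditions on these coefficients for |alpha| <= 2 give
   the sum of the k x k principal minors containing a given vertex or a given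
   pair. Since each minor is b + (a - b) [minor = a] + (c - b) [minor = c], these
   sums and the design parameters of the c-hypergraph determine those of the
   a-hypergraph. *)
Require Import Defs.
From HB Require Import structures.
From mathcomp Require Import all_boot all_order all_algebra.
From mathcomp Require Import finmap reals complex.
From mathcomp Require Import ring.

Set Implicit Arguments.
Unset Strict Implicit.
Unset Printing Implicit Defensive.

Import Order.TTheory GRing.Theory Num.Theory.
Local Open Scope ring_scope.

(* Both sides are Schur-complement evaluations of det [1, -X; Y, 1]. *)
Lemma det_add1_mulmxC (S : comNzRingType) (m n : nat)
    (X : 'M[S]_(m, n)) (Y : 'M[S]_(n, m)) :
  \det (1%:M + X *m Y) = \det (1%:M + Y *m X).
Proof.
have El : block_mx 1%:M 0 Y 1%:M *m block_mx 1%:M (- X) 0 (1%:M + Y *m X)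
          = block_mx 1%:M (- X) Y 1%:M.
  rewrite mulmx_block !mul1mx !mulmx1 !mul0mx !addr0 mulmxN.
  by rewrite addrC addrK.
have Er : block_mx (1%:M + X *m Y) (- X) 0 1%:M *m block_mx 1%:M 0 Y 1%:M
          = block_mx 1%:M (- X) Y 1%:M.
  by rewrite mulmx_block !mul1mx !mulmx1 !mul0mx !mulmx0 !add0r mulNmx addrK.
move: (congr1 determinant El); rewrite -Er !det_mulmx.
by rewrite !det_lblock !det_ublock !det1 !(mulr1, mul1r).
Qed.

(** * Principal minors and the coefficients of characteristic polynomials *)

Section Minors.
Variables (S : comNzRingType) (n : nat).
Implicit Types (M : 'M[S]_n) (beta : {set 'I_n}).

Local Notation minor_mx beta M :=
  (mxsub (@enum_val _ (mem beta)) (@enum_val _ (mem beta)) M).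

(** Replacing the minor by a matrix of fixed size [n] avoids changing index types. If [P] selects
    the rows in [beta], the minor is [1 + P (M - 1) P^T]; swapping the factors gives
    [1 + P^T P (M - 1)], whose rows are those of [M] inside [beta] and of the identity outside. *)
Lemma det_minor M beta :
  \det (minor_mx beta M)
  = \det (\matrix_(i, j) if i \in beta then M i j else (i == j)%:R).
Proof.
set e := @enum_val _ (mem beta).
pose P : 'M[S]_(#|beta|, n) := rowsub e 1%:M.
have PQ B : P *m B = rowsub e B by rewrite mul_rowsub_mx mul1mx.
have QP (m : nat) (B : 'M[S]_(m, n)) : B *m P^T = colsub e B.
  have -> : P^T = colsub e 1%:M by rewrite trmx_mxsub trmx1.
  by rewrite mulmx_colsub mulmx1.
transitivity (\det (1%:M + P *m ((M - 1%:M) *m P^T))).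
  rewrite PQ QP; congr determinant; apply/matrixP => i j.
  by rewrite !mxE (inj_eq enum_val_inj) addrC subrK.
rewrite (mulmxA P) det_add1_mulmxC; congr determinant.
apply/matrixP => i j; rewrite !mxE.
under eq_bigr do rewrite PQ !mxE.
under eq_bigr => l _ do rewrite -/(e l).
rewrite -(big_enum_val (fun l => (l == i)%:R * (M l j - (l == j)%:R))) /=.
have [ib|ib] := boolP (i \in beta).
  rewrite (bigD1 i) //= eqxx mul1r big1 ?addr0 ?[_ + (_ - _)]addrC ?subrK //.
  by move=> l /andP[_ /negPf->]; rewrite mul0r.
rewrite big1 ?addr0 // => l lb.
by case: eqP lb ib => [->->|_ _ _] //; rewrite mul0r.
Qed.

(** Multilinearity in the rows: in each Leibniz term the product of sums is distributed over the set
    [beta] of rows where the entry of [M] is chosen. The factors [D 0 i] of the other rows are then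
    pulled out, leaving the padded matrix of [det_minor]. *)
Lemma det_add_diag_mx M (D : 'rV[S]_n) :
  \det (M + diag_mx D)
  = \sum_beta (\prod_(i in ~: beta) D 0 i) * \det (minor_mx beta M).
Proof.
transitivity (\sum_(beta : {set 'I_n})
    \det (\matrix_(i, j) if i \in beta then M i j else D 0 i *+ (i == j))).
  rewrite exchange_big /=; apply: eq_bigr => s _.
  rewrite -big_distrr /=; congr (_ * _).
  under eq_bigr do rewrite !mxE.
  rewrite bigA_distr; apply: eq_bigr => beta _.
  by apply: eq_bigr => i _; rewrite mxE.
apply: eq_bigr => beta _.
rewrite det_minor.
pose E : 'rV[S]_n := \row_i if i \in beta then 1 else D 0 i.
transitivity (\det (diag_mx E *m
    (\matrix_(i, j) if i \in beta then M i j else (i == j)%:R))).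
  congr determinant; apply/matrixP => i j; rewrite mul_diag_mx !mxE.
  by case: ifP; rewrite ?mul1r // mulr_natr.
rewrite det_mulmx det_diag; congr (_ * _).
rewrite (bigID (mem beta)) /= big1 ?mul1r => [|i ib]; last by rewrite mxE ib.
by apply: eq_big => i; rewrite ?inE // mxE => /negPf->.
Qed.

End Minors.

Section CharPolyMinors.
Variables (S : comNzRingType) (n : nat).
Implicit Types (A : 'M[S]_n) (beta gamma : {set 'I_n}).

Local Notation minor_mx beta A :=
  (mxsub (@enum_val _ (mem beta)) (@enum_val _ (mem beta)) A).

(** After padding to size [n], the matrix is [M + diag_mx D], with zero rows of [M] and entries 1 of
    [D] outside [gamma]. A [beta] not inside [gamma] meets a zero row and contributes 0; for the
    others the factors of [D] give one ['X] per element of [gamma :\: beta]. *)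
Lemma char_poly_minor A gamma :
  char_poly (minor_mx gamma A)
  = \sum_(beta : {set 'I_n} | beta \subset gamma)
      ((-1) ^+ #|beta| * \det (minor_mx beta A)) *: 'X^(#|gamma| - #|beta|).
Proof.
have charE : char_poly_mx (minor_mx gamma A) = minor_mx gamma (char_poly_mx A).
  by apply/matrixP => i j; rewrite !mxE (inj_eq enum_val_inj).
rewrite /char_poly charE det_minor.
pose M : 'M[{poly S}]_n :=
  \matrix_(i, j) if i \in gamma then - (A i j)%:P else 0.
pose D : 'rV[{poly S}]_n := \row_i if i \in gamma then 'X else 1.
transitivity (\det (M + diag_mx D)).
  congr determinant; apply/matrixP => i j; rewrite !mxE.
  by case: ifP => _; rewrite ?add0r // addrC.
rewrite det_add_diag_mx (bigID (fun beta => beta \subset gamma)) /=.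
rewrite [X in _ + X]big1 ?addr0 => [|beta /subsetPn[i ib ig]]; last first.
  rewrite (expand_det_row _ (enum_rank_in ib i)) [X in _ * X]big1 ?mulr0 // => j _.
  by rewrite !mxE enum_rankK_in // (negPf ig) mul0r.
apply: eq_bigr => beta /[dup] bg /subsetP sbg.
have -> : minor_mx beta M = (-1) *: map_mx polyC (minor_mx beta A).
  by apply/matrixP => i j; rewrite !mxE sbg ?enum_valP // mulN1r.
rewrite detZ det_map_mx mulrC -mul_polyC rmorphM rmorphXn rmorphN1; congr (_ * _).
rewrite (bigID (mem gamma)) /= [X in _ * X]big1 ?mulr1 => [|i]; last first.
  by rewrite mxE => /andP[_ /negPf->].
under eq_bigr => i /andP[_ ig] do rewrite mxE ig.
rewrite (eq_bigl (mem (gamma :\: beta))) => [|i]; last by rewrite !inE.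
by rewrite prodr_const cardsD (setIidPr bg).
Qed.

End CharPolyMinors.

Lemma char_coefE (F : fieldType) (v : nat) (A : 'M[F]_v) alpha k :
  char_coef A alpha k
  = (-1) ^+ k * \sum_(beta in ksubsets v k | beta \subset ~: alpha)
                  \det (principal_submx A beta).
Proof.
have cardC : #|~: alpha| = (v - #|alpha|)%N by rewrite cardsCs setCK card_ord.
have le_av : (#|alpha| <= v)%N by rewrite -[v in leqRHS]card_ord max_card.
(* When [k + #|alpha|] exceeds [v], no [k]-subset avoids [alpha]: the empty sum matches the default
   value 0. *)
rewrite /char_coef; case: ifPn => [le_kav|gt_kav]; last first.
  rewrite big_pred0 ?mulr0 // => beta; rewrite inE; apply/negbTE/negP.
  case/andP=> /eqP bk /subset_leq_card; rewrite bk cardC; apply/negP.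
  by rewrite leq_subRL // addnC.
rewrite char_poly_minor coef_sum mulr_sumr.
under [RHS]eq_bigl => beta do rewrite andbC inE.
rewrite [RHS]big_mkcondr /=; apply: eq_bigr => beta /subset_leq_card.
rewrite cardC => le_b; rewrite coefZ coefXn.
(* Both [k] and [#|beta|] are at most [v - #|alpha|], so the truncated subtractions can be
   cancelled. *)
have -> : (v - k - #|alpha| == v - #|alpha| - #|beta|)%N = (#|beta| == k).
  have le_k : (k <= v - #|alpha|)%N by rewrite leq_subRL // addnC.
  by rewrite subnAC eqn_sub2lE // eq_sym.
case: (#|beta| =P k) => [bk|_]; last by rewrite mulr0.
by rewrite mulr1 {1}bk.
Qed.

(** * Inclusion-exclusion and counts of [k]-subsets *)

Section InclusionExclusion.
Variables (V : zmodType) (T : finType) (K : {set {set T}}) (f : {set T} -> V).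

Let avoid (alpha : {set T}) := \sum_(beta in K | beta \subset ~: alpha) f beta.

Let avoid1E (x : T) (beta : {set T}) : (beta \subset ~: [set x]) = (x \notin beta).
Proof. by rewrite -disjoints_subset disjoint_sym disjoints1. Qed.

Lemma sum_contain1 (x : T) :
  \sum_(beta in K | x \in beta) f beta = avoid set0 - avoid [set x].
Proof.
rewrite /avoid !big_mkcondr /= -sumrB; apply: eq_bigr => beta _.
by rewrite setC0 subsetT avoid1E; case: ifP => _; rewrite ?subr0 ?subrr.
Qed.

(** Checked for each [beta] separately, by expanding the indicator [(1 - [x \notin beta]) (1 -
    [y \notin beta])]; this also covers [x = y]. *)
Lemma sum_contain2 (x y : T) :
  \sum_(beta in K | [set x; y] \subset beta) f beta
  = avoid set0 - avoid [set x] - avoid [set y] + avoid [set x; y].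
Proof.
rewrite /avoid !big_mkcondr /= -!sumrB -big_split /=; apply: eq_bigr => beta _.
rewrite setC0 subsetT setCU subsetI !avoid1E subUset !sub1set.
by case: (x \in beta); case: (y \in beta); rewrite /= ?(subr0, addr0, subrr, sub0r, addNr).
Qed.

End InclusionExclusion.

Lemma card_ksubsets_avoid (v k : nat) (alpha : {set 'I_v}) :
  #|[set beta in ksubsets v k | beta \subset ~: alpha]| = 'C(v - #|alpha|, k).
Proof.
have <- : #|~: alpha| = (v - #|alpha|)%N by rewrite cardsCs setCK card_ord.
rewrite -cards_draws; apply: eq_card => beta.
by rewrite !inE andbC.
Qed.

Section CountKsubsets.
Variables (F : comNzRingType) (v k : nat).

Let sum1_avoid (alpha : {set 'I_v}) :
  \sum_(beta in ksubsets v k | beta \subset ~: alpha) 1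
  = 'C(v - #|alpha|, k)%:R :> F.
Proof.
by rewrite -card_ksubsets_avoid -sumr_const; apply: eq_bigl => beta; rewrite !inE.
Qed.

Lemma card_ksubsets_contain1 (x : 'I_v) :
  #|[set beta in ksubsets v k | x \in beta]|%:R
  = 'C(v, k)%:R - 'C(v.-1, k)%:R :> F.
Proof.
rewrite -sumr_const (eq_bigl _ _ (in_set _)) /= sum_contain1 !sum1_avoid.
by rewrite cards0 cards1 subn0 subn1.
Qed.

Lemma card_ksubsets_contain2 (x y : 'I_v) : x != y ->
  #|[set beta in ksubsets v k | [set x; y] \subset beta]|%:R
  = (binom_sub2 v k)%:R :> F.
Proof.
move=> xy; rewrite -sumr_const (eq_bigl _ _ (in_set _)) /= sum_contain2.
rewrite !sum1_avoid cards0 !cards1 cards2 xy /binom_sub2.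
have : (1 < v)%N by rewrite -[v]card_ord; apply/card_gt1P; exists x, y.
case: v => [|[|w]] // _; rewrite subn0 subn1 !subSS subn0 /=.
(* The second difference of binomials vanishes for [k] equal to 0 and 1, as [binom_sub2] does; from
   2 on, Pascal's rule applies. *)
case: k => [|[|l]] /=; first by rewrite !bin0; ring.
  by rewrite !bin1; ring.
by rewrite !subSS subn0 !binS !natrD; ring.
Qed.

End CountKsubsets.

(** * Sums of minors taking exactly three values *)

Section ThreeMinors.
Variables (F : fieldType) (v k : nat) (A : 'M[F]_v) (a b c : F).
Hypothesis hD : minor_set A k = [fset a; b; c]%fset.
Hypothesis hD3 : #|` minor_set A k|%fset = 3%N.

Lemma minor_set_distinct : [/\ a != b, a != c & b != c].
Proof.
move: hD3; rewrite hD => h3.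
(* Stated for any listing of the set, so that reordering yields all three inequalities. *)
have neq (p q r : F) : [fset a; b; c]%fset = [fset p; q; r]%fset -> p != q.
  move=> e; apply/eqP => pq; move: h3; rewrite e pq fsetUid cardfs2.
  by case: (_ != _).
split; apply: neq.
- by [].
- by rewrite fsetUAC.
- by rewrite [RHS]fsetUC fsetUA.
Qed.

Lemma sum_minors (Q : pred {set 'I_v}) :
  \sum_(beta in ksubsets v k | Q beta) \det (principal_submx A beta)
  = b * #|[set beta in ksubsets v k | Q beta]|%:R
    + (a - b) * #|[set beta in minor_hypergraph A k a | Q beta]|%:R
    + (c - b) * #|[set beta in minor_hypergraph A k c | Q beta]|%:R.
Proof.
have [ab ac bc] := minor_set_distinct.
rewrite -!sumr_const !mulr_sumr !(eq_bigl _ _ (in_set _)) /=.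
rewrite [X in _ + X + _](eq_bigl (fun beta => [&& beta \in ksubsets v k, Q beta
  & \det (principal_submx A beta) == a])); last first.
  by move=> beta; rewrite !inE andbAC andbA.
rewrite [X in _ + X](eq_bigl (fun beta => [&& beta \in ksubsets v k, Q beta
  & \det (principal_submx A beta) == c])); last first.
  by move=> beta; rewrite !inE andbAC andbA.
under [X in _ + X + _]eq_bigl => beta do rewrite andbA.
under [X in _ + X]eq_bigl => beta do rewrite andbA.
rewrite [X in _ + X + _]big_mkcondr [X in _ + X]big_mkcondr -!big_split /=.
apply: eq_bigr => beta /andP[bk _].
have : \det (principal_submx A beta) \in minor_set A k.
  by apply/imfsetP; exists beta.
rewrite hD !inE -orbA => /or3P[]/eqP->; rewrite ?eqxx.
- by rewrite (negPf ac) !mulr1 addr0 addrC subrK.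
- by rewrite eq_sym (negPf ab) (negPf bc) mulr1 !addr0.
- by rewrite eq_sym (negPf ac) !mulr1 addr0 addrC subrK.
Qed.

End ThreeMinors.

(** On the diagonal the identity already accounts for the entry 1 of the all-ones matrix. The other
    classes contribute nonnegative terms with sum 0, so none of them contains [(x, x)]. *)
Lemma scheme_class_neq (F : numFieldType) (v d : nat)
    (R : 'I_d.+1 -> {set 'I_v * 'I_v}) (j : 'I_d) (x y : 'I_v) :
  symmetric_association_scheme R F -> (x, y) \in R (lift ord0 j) -> x != y.
Proof.
case=> _ _ A0 AJ _ xyR; apply/eqP => exy; move: xyR; rewrite -exy => xxR.
move/matrixP/(_ x x): AJ; rewrite big_ord_recl A0 !mxE summxE eqxx.
move/eqP; rewrite -subr_eq0 addrAC subrr add0r (bigD1 j) //= !mxE xxR.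
rewrite gt_eqF // ltr_pwDl ?ltr01 // sumr_ge0 // => i _.
by rewrite mxE ler0n.
Qed.

Theorem theorem3p8 (RR : realType) (v d : nat)
    (R : 'I_d.+1 -> {set 'I_v * 'I_v})
    (hX : symmetric_association_scheme R (complex RR))
    (k : nat) (hk : (0 < k)%N)
    (A : 'M[complex RR]_v) (hA : diagonalizable A)
    (a b c : complex RR)
    (hD : minor_set A k = [fset a; b; c]%fset)
    (hD3 : #|` minor_set A k|%fset = 3%N)
    (c0 c1 : complex RR) (c2 : 'I_d -> complex RR)
    (hc0 : forall alpha, alpha \in ksubsets v 0 -> char_coef A alpha k = c0)
    (hc1 : forall alpha, alpha \in ksubsets v 1 -> char_coef A alpha k = c1)
    (hc2 : forall (j : 'I_d) alpha, alpha \in unordered_rel R (lift ord0 j) ->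
             char_coef A alpha k = c2 j)
    (eta2 : 'I_d -> nat)
    (hc : PBIBD R k eta2 (minor_hypergraph A k c)) :
  exists lambda : 'I_d -> nat,
    PBIBD R k lambda (minor_hypergraph A k a) /\
    forall j : 'I_d,
      (lambda j)%:R = (-1) ^+ k / (a - b) * (c0 - 2 * c1 + c2 j)
                      - b / (a - b) * (binom_sub2 v k)%:R
                      - (c - b) / (a - b) * (eta2 j)%:R.

Proof.
have [ab ac bc] := minor_set_distinct hD hD3.
have ab0 : a - b != 0 by rewrite subr_eq0.
have avoidE alpha : \sum_(beta in ksubsets v k | beta \subset ~: alpha)
    \det (principal_submx A beta) = (-1) ^+ k * char_coef A alpha k.
  by rewrite char_coefE mulrA -expr2 sqrr_sign mul1r.
have c0E : char_coef A set0 k = c0 by apply: hc0; rewrite inE cards0.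
have c1E x : char_coef A [set x] k = c1 by apply: hc1; rewrite inE cards1.
have [Hc_unif [rc rc_gt0 rcE] etaE] := hc.
(* The right-hand side does not mention [x], which gives the constant degree of a 1-design. *)
have degE x : #|[set e in minor_hypergraph A k a | x \in e]|%:R =
    ((-1) ^+ k * (c0 - c1) - b * ('C(v, k)%:R - 'C(v.-1, k)%:R)
      - (c - b) * rc%:R) / (a - b) :> complex RR.
  have := sum_minors hD hD3 (fun e : {set 'I_v} => x \in e).
  rewrite sum_contain1 !avoidE c0E c1E card_ksubsets_contain1 rcE => E.
  apply: (canRL (mulfK ab0)); rewrite [_ * (c0 - c1)]mulrBr E; ring.
pose L j := (-1) ^+ k / (a - b) * (c0 - 2 * c1 + c2 j)
  - b / (a - b) * (binom_sub2 v k)%:R - (c - b) / (a - b) * (eta2 j)%:R.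
have codegE j x y : (x, y) \in R (lift ord0 j) ->
    #|[set e in minor_hypergraph A k a | [set x; y] \subset e]|%:R = L j.
  move=> xyR; have xy := scheme_class_neq hX xyR.
  have c2E : char_coef A [set x; y] k = c2 j.
    by apply: hc2; apply/imsetP; exists (x, y).
  have := sum_minors hD hD3 (fun e : {set 'I_v} => [set x; y] \subset e).
  rewrite sum_contain2 !avoidE c0E !c1E c2E (card_ksubsets_contain2 _ _ xy).
  rewrite (etaE _ _ _ xyR) => E.
  apply: (mulIf ab0); rewrite mulrC.
  transitivity ((-1) ^+ k * (c0 - 2 * c1 + c2 j) - b * (binom_sub2 v k)%:R
    - (c - b) * (eta2 j)%:R); last by rewrite /L; field.
  (* Expanded so that the left side of [E] occurs literally and can be rewritten. *)
  transitivity ((-1) ^+ k * c0 - (-1) ^+ k * c1 - (-1) ^+ k * c1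
    + (-1) ^+ k * c2 j - b * (binom_sub2 v k)%:R - (c - b) * (eta2 j)%:R).
    by rewrite E; ring.
  by ring.
have [_ R_neq0 _ _ _] := hX.
(* [L j] is only a complex number, whereas [lambda j] must be a natural one: it is taken as the
   count at a chosen pair of the nonempty class, and [codegE] makes the choice immaterial. *)
have rep j : {xy | xy \in R (lift ord0 j)} by apply/sigW/set0Pn.
exists (fun j => #|[set e in minor_hypergraph A k a
  | [set (sval (rep j)).1; (sval (rep j)).2] \subset e]|); split.
- split.
  + by move=> e; rewrite !inE => /andP[/eqP].
  (* Positive degree: [a] is attained by some [k]-subset, which is nonempty as [0 < k], so one of
     its vertices lies in a hyperedge. *)
  + have : a \in minor_set A k by rewrite hD !inE eqxx.
    case/imfsetP => e /= ek aE.
    have ea : e \in minor_hypergraph A k a by rewrite inE ek -aE eqxx.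
    have [x xe] : exists x, x \in e.
      by apply/card_gt0P; move: ek; rewrite inE => /eqP->.
    exists #|[set e in minor_hypergraph A k a | x \in e]| => [|y].
      by apply/card_gt0P; exists e; rewrite inE ea.
    by apply/eqP; rewrite -(eqr_nat (complex RR)) !degE.
  + move=> j x y xyR; apply/eqP; rewrite -(eqr_nat (complex RR)).
    by rewrite (codegE _ _ _ xyR) (codegE j) // -surjective_pairing (svalP (rep j)).
- by move=> j; rewrite (codegE j) // -surjective_pairing (svalP (rep j)).
Qed.
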